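(* Let $n\ge 3$ be an integer. Then $\Gamma(D_n)$ is a triangle-free graph if and only if $n$ is a power of an odd prime.
   Context: For a finite group $G$, the co-maximal subgroup graph $\Gamma(G)$ is the simple undirected graph whose vertices are the non-trivial proper subgroups of $G$, two distinct vertices $H,K$ being adjacent if and only if $HK=G$, where $HK=\{hk: h\in H, k\in K\}$. $D_n=\langle r,s: r^n=s^2=1,\ srs^{-1}=r^{-1}\rangle$ is the dihedral group of order $2n$. A graph is triangle-free if it contains no cycle of length $3$. *)

(* Defs.v *)
From mathcomp Require Import all_boot all_fingroup all_solvable.

Set Implicit Arguments.
Unset Strict Implicit.
Unset Printing Implicit Defensive.

Local Open Scope group_scope.

Record sgraph := SGraph {
  vertex :> finType;
  adj : rel vertex;
  adj_sym : symmetric adj;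
  adj_irrefl : irreflexive adj
}.

Definition triangle_free (g : sgraph) : Prop :=
  ~ exists c : seq g, ucycle (@adj g) c /\ size c = 3.

Section ComaximalGraph.

Variables (gT : finGroupType) (G : {group gT}).

Definition nontrivial_proper : pred {group gT} :=
  [pred H : {group gT} | (H \proper G) && (H :!=: 1)].

Definition comax_vertex := {H : {group gT} | nontrivial_proper H}.

Definition comax_adj : rel comax_vertex :=
  fun H K => (H != K) && (val H * val K == G :> {set gT}).

Lemma comax_adj_sym : symmetric comax_adj.
Proof.
have sym1 (H K : comax_vertex) : comax_adj H K -> comax_adj K H.
  case/andP=> neHK /eqP eqG; rewrite /comax_adj /= eq_sym neHK /=.
  have /comm_group_setP cHK: group_set (val H * val K) by rewrite eqG groupP.
  by rewrite -cHK eqG.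
by move=> H K; apply/idP/idP; apply: sym1.
Qed.

Lemma comax_adj_irrefl : irreflexive comax_adj.
Proof. by move=> H; rewrite /comax_adj /= eqxx. Qed.

Definition comax_graph : sgraph := SGraph comax_adj_sym comax_adj_irrefl.

End ComaximalGraph.

(* The subscript of 'D_m is the order of the group, so the dihedral group
   <r, s | r^n = s^2 = 1, s r s^-1 = r^-1> of order 2n is 'D_(2 * n). *)
Lemma dihedral_presentation (n : nat) : 1 < n ->
  'D_(2 * n) \isog Grp (r : s : r ^+ n, s ^+ 2, s * r * s^-1 = r^-1).
Proof.
move=> n_gt1 rT H.
rewrite mul2n Grp_dihedral //.
apply/existsP/existsP => -[[x y]] /= /eqP[defH xn y2 cxy];
  exists (x, y); rewrite /= !xpair_eqE defH xn y2 !eqxx /=;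
  have yV : y^-1 = y by apply/eqP; rewrite eq_invg_mul -y2.
- by rewrite -cxy conjgE yV mulgA.
- by rewrite -cxy conjgE yV mulgA.
Qed.

(* Main.v *)
Require Import Defs.
From mathcomp Require Import all_boot all_fingroup all_solvable.

(** Let [R] be the rotation subgroup of the dihedral group [G] of order [2n]:
    it is cyclic of index 2. A triangle of the co-maximal graph is the same as
    three proper subgroups with pairwise products [G]
    (lemma [comax_triangle_freeP]); distinctness and nontriviality come for
    free.

    If [n] is even, the rotations and the two dihedral subgroups
    [<r^2, s>] and [<r^2, rs>] are three distinct subgroups of index 2, hence
    maximal and normal, so they form a triangle ([comax_triangle_even]).

    If [n] is odd and has two distinct prime divisors [p] and [q], then three
    primes 2, [p], [q] divide the order of the solvable group [G]. Hall
    complements for these primes are proper subgroups with pairwise coprime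
    indices, so they form a triangle ([comax_triangle_solvable]).

    If [n] is a power of an odd prime, two subgroups of [R] are never
    adjacent, so a triangle would contain two adjacent vertices [H] and [K]
    not contained in [R]. The subgroups of the cyclic [p]-group [R] form a
    chain, say [H :&: R \subset K :&: R]. Since [H :&: R] has index 2 in [H],
    this gives [#|G| = #|H * K| <= 2 * #|K|], whereas [#|G : K|] divides
    [#|R|] and so is odd and greater than 1 ([mulG_cyclic_pgroup_index2]). *)

Section ComaximalTriangles.

Set Implicit Arguments.
Unset Strict Implicit.
Unset Printing Implicit Defensive.
Local Open Scope group_scope.

(** * Triangles as triples of subgroups *)

(** Three proper subgroups with pairwise products [G]: a triangle of the
    co-maximal graph of [G], with an ordering of its vertices. *)
Definition comax_triangle {gT : finGroupType} (G H K L : {group gT}) : Prop :=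
  [/\ H \proper G, K \proper G & L \proper G]
  /\ [/\ H * K = G, K * L = G & L * H = G].

Section AbstractGroup.

Context {gT : finGroupType}.
Implicit Types G H K L R : {group gT}.

Lemma comax_nontrivial G H K : K \proper G -> H * K = G -> H :!=: 1.
Proof.
move=> prK defG; apply: contraTneq prK => H1.
by rewrite properE -defG H1 mul1g subxx andbF.
Qed.

Lemma comax_neq G H K : K \proper G -> H * K = G -> H != K.
Proof.
move=> prK defG; apply: contraTneq prK => eqHK.
by rewrite properE -defG eqHK mulGid subxx andbF.
Qed.

Lemma comax_triangle_freeP G :
  triangle_free (comax_graph G) <-> ~ exists H K L, comax_triangle G H K L.
Proof.
split=> [freeG [H [K [L [[prH prK prL] [HK KL LH]]]]] | noT [c [uc sz_c]]].
  have vH : nontrivial_proper G H by rewrite /nontrivial_proper /= prH (comax_nontrivial prK).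
  have vK : nontrivial_proper G K by rewrite /nontrivial_proper /= prK (comax_nontrivial prL).
  have vL : nontrivial_proper G L by rewrite /nontrivial_proper /= prL (comax_nontrivial prH).
  pose h : comax_vertex G := Sub H vH.
  pose k : comax_vertex G := Sub K vK.
  pose l : comax_vertex G := Sub L vL.
  have nHK : h != k by rewrite -val_eqE /= (comax_neq prK).
  have nKL : k != l by rewrite -val_eqE /= (comax_neq prL).
  have nLH : l != h by rewrite -val_eqE /= (comax_neq prH).
  apply: freeG; exists [:: h; k; l]; split=> //.
  rewrite /ucycle /= /comax_adj nHK nKL nLH /= HK KL LH !eqxx /=.
  by rewrite !inE negb_or nHK nKL eq_sym nLH.
case: c uc sz_c => [|h [|k [|l [|? ?]]]] //= /andP[/= + _] _.
rewrite andbT => /and3P[/andP[_ /eqP HK] /andP[_ /eqP KL] /andP[_ /eqP LH]].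
apply: noT; exists (val h), (val k), (val l).
have prV (v : comax_vertex G) : val v \proper G by case/andP: (valP v).
by do 2?split.
Qed.

(** * Groups with a cyclic subgroup of odd prime power order and index 2 *)

Lemma index2_maximal G H : H \subset G -> #|G : H| = 2 -> maximal H G.
Proof. by move=> sHG iH; apply: p_index_maximal; rewrite ?iH. Qed.

Lemma index2_mulG G H K :
  H \subset G -> #|G : H| = 2 -> K \subset G -> ~~ (K \subset H) -> H * K = G.
Proof.
move=> sHG iH sKG nKH; apply: mulg_normal_maximal => //.
  exact: index2_normal.
exact: index2_maximal.
Qed.

Lemma mulG_cyclic_pgroup_index2 (p : nat) G R H K :
    cyclic R -> p.-group R -> odd p -> R \subset G -> #|G : R| = 2 ->
    H \proper G -> K \proper G -> ~~ (H \subset R) -> ~~ (K \subset R) ->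
  H * K <> G.
Proof.
move=> cycR pR odd_p sRG iR prH prK nHR nKR defG.
have oHK : (#|H| * #|K| = #|G| * #|H :&: K|)%N by rewrite mul_cardG defG.
have oddR : odd #|R|.
  by have [j ->] := p_natP pR; rewrite oddX odd_p orbT.
(* The product identity [oHK] is symmetric in [H] and [K], unlike [defG]. *)
move: {defG} oHK prH prK nHR nKR.
wlog sHK : H K / H :&: R \subset K :&: R.
  move=> IH oHK prH prK nHR nKR.
  have [/p_natP[i Di] /p_natP[j Dj]] : p.-group (H :&: R) /\ p.-group (K :&: R).
    by split; apply: pgroupS pR; apply: subsetIr.
  have [leij | leji] := leqP i j.
    apply: (IH H K) => //; rewrite -(cardSg_cyclic cycR) ?subsetIr //.
    by rewrite Di Dj dvdn_exp2l.
  apply: (IH K H) => //.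
    by rewrite -(cardSg_cyclic cycR) ?subsetIr // Di Dj dvdn_exp2l // ltnW.
  by rewrite setIC mulnC.
move=> oHK prH prK nHR nKR.
have [sHG sKG] := (proper_sub prH, proper_sub prK).
have iHR : #|H : R| = 2.
  apply/eqP; rewrite -(eqn_pmul2l (cardG_gt0 R)) LagrangeMl.
  by rewrite (index2_mulG sRG) // -(Lagrange sRG) iR.
have odd_iK : odd #|G : K|.
  apply: (dvdn_odd _ oddR); suff -> : #|G : K| = #|R : K| by apply: dvdn_indexg.
  apply/eqP; rewrite -(eqn_pmul2l (cardG_gt0 K)) Lagrange // mulnC LagrangeMr.
  by rewrite (index2_mulG sRG).
have leH : #|H| <= 2 * #|H :&: K|.
  rewrite -(LagrangeI H R) iHR mulnC leq_mul2l /= subset_leq_card //.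
  by rewrite subsetI subsetIl (subset_trans sHK) ?subsetIl.
have iK_le2 : #|G : K| <= 2.
  rewrite -(leq_pmul2l (cardG_gt0 K)) Lagrange //.
  rewrite -(leq_pmul2r (cardG_gt0 (H :&: K)%G)) -oHK -mulnA mulnC.
  by rewrite leq_pmul2l.
have iK_gt1 : 1 < #|G : K| by rewrite indexg_gt1 (proper_subn prK).
by case: #|G : K| odd_iK iK_le2 iK_gt1 => [|[|[|]]].
Qed.

(** Among three subgroups, two lie in [R] or two do not; in either case their
    product is not [G]. *)
Lemma no_comax_triangle_cyclic_pgroup_index2 (p : nat) G R H K L :
    cyclic R -> p.-group R -> odd p -> R \subset G -> #|G : R| = 2 ->
  ~ comax_triangle G H K L.
Proof.
move=> cycR pR odd_p sRG iR [[prH prK prL] [HK KL LH]].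
have prR : R \proper G by rewrite properE sRG -indexg_gt1 iR.
have ins (A B : {group gT}) : A \subset R -> B \subset R -> A * B = G -> False.
  move=> sAR sBR AB; case/andP: prR => _ /negP; apply.
  by rewrite -AB mul_subG.
have out (A B : {group gT}) : A \proper G -> B \proper G ->
    ~~ (A \subset R) -> ~~ (B \subset R) -> A * B = G -> False.
  by move=> ? ? ? ?; apply: (mulG_cyclic_pgroup_index2 cycR pR).
case: (boolP (H \subset R)) (boolP (K \subset R)) (boolP (L \subset R)).
- by move=> sH [sK|nK] [sL|nL];
    first [exact: ins HK | exact: ins LH | exact: out KL].
- by move=> nH [sK|nK] [sL|nL];
    first [exact: out HK | exact: out LH | exact: ins KL].
Qed.

(** * Solvable groups whose order has three prime divisors *)

Lemma comax_triangle_solvable G (p q r : nat) :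
    solvable G -> prime p -> prime q -> prime r ->
    p != q -> q != r -> r != p ->
    p %| #|G| -> q %| #|G| -> r %| #|G| ->
  exists H K L, comax_triangle G H K L.
Proof.
move=> solG p_pr q_pr r_pr npq nqr nrp pG qG rG.
have prop u (A : {group gT}) : prime u -> u %| #|G| -> u^'.-Hall(G) A -> A \proper G.
  move=> u_pr uG hallA; rewrite properEcard (pHall_sub hallA) /=.
  rewrite ltn_neqAle subset_leq_card ?(pHall_sub hallA) // andbT.
  apply/eqP=> eqAG; case/and3P: hallA => _ + _.
  by rewrite /pgroup eqAG p'natE // uG.
have com u v (A B : {group gT}) : prime v -> u != v ->
    u^'.-Hall(G) A -> v^'.-Hall(G) B -> A * B = G.
  move=> v_pr nuv /and3P[sAG _ uA] /and3P[sBG _ vB].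
  apply: coprime_index_mulG => //; apply: pnat_coprime uA _.
  rewrite pnatNK pnatNK in vB *; apply: sub_in_pnat vB => w _.
  by rewrite !inE => /eqP->; rewrite eq_sym.
have [H hH] := Hall_exists p^' solG.
have [K hK] := Hall_exists q^' solG.
have [L hL] := Hall_exists r^' solG.
exists H, K, L; do 2?split; first [exact: prop hH | exact: prop hK
  | exact: prop hL | exact: com hH hK | exact: com hK hL | exact: com hL hH].
Qed.

(** * Three subgroups of index 2 *)

(** With [N] generated by the square of [r], the dihedral subgroup [N <[x]>] of
    a reflection [x] has the same order as the rotation subgroup [<[r]>]. *)
Lemma reflection_index2 G (r x : gT) :
    r \in G -> #|G : <[r]>| = 2 -> 2 %| #[r] ->
    x \in G -> x \notin <[r]> -> x ^+ 2 = 1 ->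
  #|G : <[x]> <*> <[r ^+ 2]>| = 2.
Proof.
move=> Gr iR even_r Gx nRx x2.
have sRG : <[r]> \subset G by rewrite cycle_subG.
have sNR : <[r ^+ 2]> \subset <[r]> by rewrite cycle_subG mem_cycle.
have nsNG : <[r ^+ 2]> <| G.
  apply: char_normal_trans (index2_normal sRG iR).
  by rewrite sub_cyclic_char ?cycle_cyclic.
have ox : #[x] = 2.
  by apply: nt_prime_order => //; apply: contraNneq nRx => ->.
have sxG : <[x]> \subset G by rewrite cycle_subG.
have sBG : <[x]> <*> <[r ^+ 2]> \subset G.
  by rewrite join_subG sxG normal_sub.
have oN : #[r ^+ 2] = #[r] %/ 2 by apply: orderXdiv.
have tiN : <[x]> :&: <[r ^+ 2]> = 1.
  rewrite prime_TIg -?orderE ?ox // cycle_subG.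
  by apply: contra nRx => /(subsetP sNR).
have oB : #|<[x]> <*> <[r ^+ 2]>| = #[r].
  rewrite norm_joinEl ?(subset_trans sxG) ?normal_norm // TI_cardMg //.
  by rewrite -!orderE ox oN mulnC divnK.
apply/eqP; rewrite -(eqn_pmul2l (order_gt0 r)) -{1}oB Lagrange //.
by rewrite -(Lagrange sRG) iR.
Qed.

Lemma comax_triangle_even G (r s : gT) :
    r \in G -> s \in G -> #|G : <[r]>| = 2 -> 2 %| #[r] ->
    s \notin <[r]> -> s ^+ 2 = 1 -> (r * s) ^+ 2 = 1 ->
  exists H K L, comax_triangle G H K L.
Proof.
move=> Gr Gs iR even_r nRs s2 rs2.
have nRrs : r * s \notin <[r]> by rewrite groupMl ?cycle_id.
have Grs : r * s \in G by rewrite groupM.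
have iB := reflection_index2 Gr iR even_r Gs nRs s2.
have iC := reflection_index2 Gr iR even_r Grs nRrs rs2.
have sRG : <[r]> \subset G by rewrite cycle_subG.
have sub x : x \in G -> <[x]> <*> <[r ^+ 2]> \subset G.
  by move=> Gx; rewrite join_subG !cycle_subG Gx groupX.
have sBG := sub s Gs; have sCG := sub (r * s) Grs.
have mem x : x \in <[x]> <*> <[r ^+ 2]>.
  by rewrite (subsetP (joing_subl _ _)) ?cycle_id.
have prop (A : {group gT}) : A \subset G -> #|G : A| = 2 -> A \proper G.
  by move=> sAG iA; rewrite properE sAG -indexg_gt1 iA.
(* Subgroups of index 2 have the same order, so inclusion is equality. *)
have nr x : x \in G -> #|G : <[x]> <*> <[r ^+ 2]>| = 2 -> x \notin <[r]> ->
    r \notin <[x]> <*> <[r ^+ 2]>.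
  move=> Gx ix nRx; apply: contra nRx => rx.
  have /eqP-> : <[r]> == <[x]> <*> <[r ^+ 2]>; last exact: mem.
  rewrite eqEcard cycle_subG rx /=; have := Lagrange (sub x Gx).
  by rewrite ix -(Lagrange sRG) iR => /eqP; rewrite eqn_pmul2r // => /eqP->.
exists <[r]>%G, (<[s]> <*> <[r ^+ 2]>)%G, (<[r * s]> <*> <[r ^+ 2]>)%G.
do 2?split; rewrite ?prop //; apply: index2_mulG => //=.
- by apply: contra nRs => /subsetP-> //.
- apply: contra (nr s Gs iB nRs) => /subsetP/(_ _ (mem _)).
  by rewrite groupMr.
- by rewrite cycle_subG nr.
Qed.

End AbstractGroup.

(** * Dihedral groups *)

(** The rotation [r] and the reflection [s]. Their orders are at most [n] and
    2 by the relations; the order of the group makes them equal. *)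
Lemma dihedral_generators n : 1 < n ->
  exists r s : 'D_(2 * n),
    [/\ #[r] = n, #|[set: 'D_(2 * n)] : <[r]>| = 2, s \notin <[r]>,
        s ^+ 2 = 1 & (r * s) ^+ 2 = 1].
Proof.
rewrite mul2n => n_gt1; have oG := card_dihedral n_gt1.
have /existsP[[r s] /= /eqP[defG rn s2 rs]] :=
  isoGrp_hom (Grp_dihedral n_gt1).
have nRs : <[s]> \subset 'N(<[r]>).
  by rewrite cycle_subG; apply/normP; rewrite -cycleJ rs cycleV.
have oRs : (#[r] * #[s] >= n * 2)%N.
  have : #|[set: 'D_n.*2]| <= #[r] * #[s].
    by rewrite -defG norm_joinEr // mul_cardG leq_pmulr.
  by rewrite oG muln2.
have le_r : #[r] <= n by rewrite dvdn_leq ?order_dvdn ?rn // ltnW.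
have le_s : #[s] <= 2 by rewrite dvdn_leq // order_dvdn s2.
have or : #[r] = n.
  apply/eqP; rewrite eqn_leq le_r -(leq_pmul2r (ltn0Sn 1)).
  by rewrite (leq_trans oRs) // leq_mul2l le_s orbT.
have iR : #|[set: 'D_n.*2] : <[r]>| = 2.
  by rewrite -divgS ?subsetT // oG -orderE or -muln2 mulKn // ltnW.
exists r, s; split=> //.
  apply/negP=> Rs; have : #|[set: 'D_n.*2]| <= #[r].
    by rewrite -defG subset_leq_card // join_subG subxx cycle_subG.
  by rewrite oG or leqNgt -addnn -[X in X < _]addn0 ltn_add2l ltnW.
have /eqP sV : s^-1 == s by rewrite eq_invg_mul -expg2 s2.
(* [(r * s)^2 = r * (s * r * s)], and [s = s^-1], so this is [r * r ^ s]. *)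
by rewrite expg2 -mulgA -{1}sV -[s^-1 * _]conjgE rs mulgV.
Qed.

End ComaximalTriangles.

Theorem theorem3p3 (n : nat) (n_ge3 : 3 <= n) :
  triangle_free (comax_graph 'D_(2 * n)%N%G) <->
  exists p k : nat, [/\ prime p, odd p, 0 < k & n = p ^ k].
Proof.
have n_gt1 : 1 < n by apply: ltnW.
have [r [s [or iR nRs s2 rs2]]] := dihedral_generators n_gt1.
have sRG : <[r]>%g \subset [set: 'D_(2 * n)] by apply: subsetT.
have oG : #|[set: 'D_(2 * n)]| = (n * 2)%N.
  by rewrite -(Lagrange sRG) iR -orderE or.
split=> [/comax_triangle_freeP noT | [p [k [p_pr odd_p k_gt0 n_pk]]]]; last first.
  apply/comax_triangle_freeP => -[H [K [L]]].
  apply: (no_comax_triangle_cyclic_pgroup_index2 (cycle_cyclic r) _ odd_p) => //.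
  by rewrite /pgroup -orderE or n_pk pnatX pnat_id.
have odd_n : odd n.
  apply: contraT => even_n; case: noT.
  by apply: (@comax_triangle_even _ _ r s); rewrite ?inE // or dvdn2.
have p_pr : prime (pdiv n) by apply: pdiv_prime.
have odd_p : odd (pdiv n) by apply: dvdn_odd (pdiv_dvd n) odd_n.
have [/p_natP[k n_pk] | ] := boolP ((pdiv n).-nat n).
  exists (pdiv n), k; split=> //.
  by case: k n_pk n_gt1 => // ->.
rewrite /pnat ltnW //= => /allPn[q + npq]; rewrite mem_primes => /and3P[q_pr _ qn].
have solG : solvable [set: 'D_(2 * n)].
  apply: metacyclic_sol; apply/metacyclicP; exists <[r]>%G.
  split; [exact: cycle_cyclic | exact: index2_normal |].
  by rewrite prime_cyclic // card_quotient ?iR // normal_norm ?index2_normal.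
case: noT; apply: (@comax_triangle_solvable _ _ 2 (pdiv n) q) => //.
- by apply: contraTneq odd_p => <-.
- by rewrite eq_sym.
- by apply: contraTneq odd_n => q2; rewrite -dvdn2 -q2.
- by rewrite oG dvdn_mull.
- by rewrite oG dvdn_mulr ?pdiv_dvd.
- by rewrite oG dvdn_mulr.
Qed.
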